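(* Let $\mathbf{h}$ be a bimonoid in species over a field $\Bbbk$ and let $I$ be a finite set. The following properties hold. (i) For any $h\in\mathbf{h}[I]$, $\mathtt{H}_{(I)}\triangleright h=h$. (ii) If $\mathbf{h}$ is cocommutative, then for any $z,w\in\widehat{\mathbf{\Sigma}}[I]$ and $h\in\mathbf{h}[I]$, $(z\triangleright w)\triangleright h=z\triangleright(w\triangleright h)$. (iii) If $\mathbf{h}$ is commutative, then for any $z,w\in\widehat{\mathbf{\Sigma}}[I]$ and $h\in\mathbf{h}[I]$, $(z\triangleright w)\triangleright h=w\triangleright(z\triangleright h)$.
   Context: Species and bimonoids. A species is a functor $\mathbf{p}$ from the category of finite sets and bijections to $\Bbbk$-vector spaces; morphisms are natural transformations. $I=S\sqcup T$ means that $(S,T)$ is an ordered pair of disjoint, possibly empty, subsets with union $I$. The Cauchy product is $(\mathbf{p}\cdot\mathbf{q})[I]=\bigoplus_{I=S\sqcup T}\mathbf{p}[S]\otimes\mathbf{q}[T]$; with the symmetry $x\otimes y\mapsto y\otimes x$ and unit the species that is $\Bbbk$ on $\emptyset$ and $0$ elsewhere, species form a symmetric monoidal category. Monoids, comonoids and bimonoids are taken in this category: a monoid has natural maps $\mu_{S,T}:\mathbf{a}[S]\otimes\mathbf{a}[T]\to\mathbf{a}[I]$ and $\iota_\emptyset:\Bbbk\to\mathbf{a}[\emptyset]$; a comonoid has natural maps $\Delta_{S,T}:\mathbf{c}[I]\to\mathbf{c}[S]\otimes\mathbf{c}[T]$ and $\epsilon_\emptyset:\mathbf{c}[\emptyset]\to\Bbbk$;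 in a bimonoid, product and unit are morphisms of comonoids. Commutative means $\mu_{S,T}(x\otimes y)=\mu_{T,S}(y\otimes x)$; cocommutative is the dual condition. A decomposition $F=(I_1,\dots,I_k)$ of $I$ ($k\ge0$) is a sequence of pairwise disjoint, possibly empty, subsets with union $I$. Write $\mathbf{h}(F)=\mathbf{h}[I_1]\otimes\cdots\otimes\mathbf{h}[I_k]$ (equal to $\Bbbk$ if $k=0$). The higher product $\mu_F:\mathbf{h}(F)\to\mathbf{h}[I]$ and higher coproduct $\Delta_F:\mathbf{h}[I]\to\mathbf{h}(F)$ are the iterated product and coproduct; they are identities for $k=1$, and $\mu_F=\iota_\emptyset$, $\Delta_F=\epsilon_\emptyset$ for $k=0$. $\widehat{\mathbf{\Sigma}}[I]$ is the vector space with basis $\mathtt{H}_F$ indexed by the decompositions $F$ of $I$; $(I)$ is the decomposition with the single block $I$. For a bimonoid $\mathbf{h}$, $h\in\mathbf{h}[I]$ and $z=\sum_F a_F\mathtt{H}_F\in\widehat{\mathbf{\Sigma}}[I]$, the characteristic operation is $z\triangleright h:=\sum_F a_F\,\mu_F\Delta_F(h)\in\mathbf{h}[I]$. On $\widehat{\mathbf{\Sigma}}[I]$ itself, $\triangleright$ denotes the bilinear Tits product $\mathtt{H}_F\triangleright\mathtt{H}_G=\mathtt{H}_{FG}$, where for $F=(S_1,\dots,S_p)$ and $G=(T_1,\dots,T_q)$, $FG$ is the list of all $pq$ intersections $S_i\cap T_j$ (empty ones included) in lexicographic order of $(i,j)$. (This is the characteristic operation for $\mathbf{h}=\widehat{\mathbf{\Sigma}}$,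 a bimonoid under concatenation and restriction of decompositions.) *)

(* Defs.v *)
From HB Require Import structures.
From mathcomp Require Import all_boot all_order all_algebra.
From mathcomp Require Import boolp.
From mathcomp Require Export freeg.

Set Implicit Arguments.
Unset Strict Implicit.
Unset Printing Implicit Defensive.

Import GRing.Theory.
Local Open Scope ring_scope.
Local Open Scope quotient_scope.

(* Classical logic ([boolp]) makes the congruence below boolean, so that the
   quotient defining the tensor product of arbitrary vector spaces is a
   [lmodType]; [tens_liftE] and [tens_ext] give its universal property. *)

Definition bilin (k : fieldType) (U V W : lmodType k) (f : U -> V -> W) : Prop :=
  (forall v, linear (f^~ v)) /\ (forall u, linear (f u)).

Section TensorProduct.
Context (k : fieldType) (U V : lmodType k).

Local Notation free := {freeg (U * V)%type / k}.

Inductive bilinear_relations : free -> Prop :=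
| relations0 : bilinear_relations 0
| relationsP a x y : bilinear_relations x -> bilinear_relations y ->
    bilinear_relations (a *: x + y)
| relationsL a u u' v : bilinear_relations
    (<< (a *: u + u', v) >> - (a *: << (u, v) >> + << (u', v) >>))
| relationsR a u v v' : bilinear_relations
    (<< (u, a *: v + v') >> - (a *: << (u, v) >> + << (u, v') >>)).

Definition tens_eq (x y : free) : bool := `[< bilinear_relations (x - y) >].

Lemma relationsN (x : free) : bilinear_relations x -> bilinear_relations (- x).
Proof.
move=> h; rewrite -[- x]addr0 -scaleN1r.
by apply: relationsP => //; apply: relations0.
Qed.

Lemma relationsD (x y : free) :
  bilinear_relations x -> bilinear_relations y -> bilinear_relations (x + y).
Proof. by move=> hx hy; rewrite -[x]scale1r; apply: relationsP. Qed.

Lemma tens_eq_refl : reflexive tens_eq.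
Proof. by move=> x; apply/asboolP; rewrite subrr; apply: relations0. Qed.

Lemma tens_eq_sym : symmetric tens_eq.
Proof.
by move=> x y; apply/asboolP/asboolP => /relationsN; rewrite opprB.
Qed.

Lemma tens_eq_trans : transitive tens_eq.
Proof.
move=> y x z /asboolP hxy /asboolP hyz; apply/asboolP.
by rewrite -(subrK y x) -addrA; apply: relationsD.
Qed.

Canonical tens_equiv := EquivRel tens_eq tens_eq_refl tens_eq_sym tens_eq_trans.

Definition tens_type := {eq_quot tens_equiv}.
HB.instance Definition _ := Choice.on tens_type.
HB.instance Definition _ := Quotient.on tens_type.
HB.instance Definition _ : EqQuotient free tens_equiv tens_type :=
  EqQuotient.on tens_type.

Lemma tens_piP (x y : free) :
  bilinear_relations (x - y) <-> \pi_tens_type x = \pi_tens_type y.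
Proof.
by split=> [h|/eqquotP /asboolP //]; apply/eqquotP/asboolP.
Qed.

Lemma tens_reprK (x : free) : bilinear_relations (repr (\pi_tens_type x) - x).
Proof. by apply/tens_piP; rewrite reprK. Qed.

Definition tens_add (x y : tens_type) : tens_type :=
  \pi_tens_type (repr x + repr y).
Definition tens_opp (x : tens_type) : tens_type := \pi_tens_type (- repr x).
Definition tens_scale (a : k) (x : tens_type) : tens_type :=
  \pi_tens_type (a *: repr x).

Lemma pi_add (x y : free) :
  \pi_tens_type (x + y) = tens_add (\pi_tens_type x) (\pi_tens_type y).
Proof.
apply/esym/tens_piP; rewrite opprD addrACA.
by apply: relationsD; apply: tens_reprK.
Qed.

Lemma pi_opp (x : free) : \pi_tens_type (- x) = tens_opp (\pi_tens_type x).
Proof.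
apply/esym/tens_piP; rewrite -opprD; apply: relationsN; exact: tens_reprK.
Qed.

Lemma pi_scale a (x : free) :
  \pi_tens_type (a *: x) = tens_scale a (\pi_tens_type x).
Proof.
apply/esym/tens_piP; rewrite -scalerBr -[_ *: _]addr0.
by apply: relationsP; [apply: tens_reprK | apply: relations0].
Qed.

Lemma tens_addA : associative tens_add.
Proof.
elim/quotW=> x; elim/quotW=> y; elim/quotW=> z.
by rewrite -(pi_add y z) -(pi_add x y) -(pi_add x) -(pi_add _ z) addrA.
Qed.
Lemma tens_addC : commutative tens_add.
Proof. by move=> x y; rewrite /tens_add addrC. Qed.
Lemma tens_add0 : left_id (\pi_tens_type 0) tens_add.
Proof. by elim/quotW=> x; rewrite -(pi_add 0 x) add0r. Qed.
Lemma tens_addN : left_inverse (\pi_tens_type 0) tens_opp tens_add.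
Proof. by elim/quotW=> x; rewrite -(pi_opp x) -(pi_add (- x) x) addNr. Qed.
HB.instance Definition _ :=
  GRing.isZmodule.Build tens_type tens_addA tens_addC tens_add0 tens_addN.

Lemma tens_scaleA a b x : tens_scale a (tens_scale b x) = tens_scale (a * b) x.
Proof.
elim/quotW: x => x.
by rewrite -(pi_scale b x) -(pi_scale a) -(pi_scale _ x) scalerA.
Qed.
Lemma tens_scale1 : left_id 1 tens_scale.
Proof. by elim/quotW=> x; rewrite -(pi_scale 1 x) scale1r. Qed.
Lemma tens_scaleDr : right_distributive tens_scale +%R.
Proof.
move=> a; elim/quotW=> x; elim/quotW=> y.
rewrite -[_ + _](pi_add x y) -(pi_scale a x) -(pi_scale a y) -(pi_scale a).
by rewrite -[RHS]pi_add scalerDr.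
Qed.
Lemma tens_scaleDl x : {morph tens_scale^~ x : a b / a + b}.
Proof.
move=> a b; elim/quotW: x => x.
by rewrite -(pi_scale a x) -(pi_scale b x) -(pi_scale _ x) -[RHS]pi_add
  scalerDl.
Qed.
HB.instance Definition _ :=
  GRing.Zmodule_isLmodule.Build k tens_type
    tens_scaleA tens_scale1 tens_scaleDr tens_scaleDl.

Definition tens : lmodType k := tens_type.

Definition tensor (u : U) (v : V) : tens := \pi_tens_type << (u, v) >>.

Lemma pi_linear : linear (\pi_tens_type : free -> tens).
Proof. by move=> a x y; rewrite (pi_add (a *: x)) (pi_scale a x). Qed.

Lemma tensor_bilin : bilin tensor.
Proof.
split=> [v a u u'|u a v v']; rewrite /tensor -pi_linear; apply/tens_piP.
- exact: relationsL.
- exact: relationsR.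
Qed.

Lemma tensorDl u u' v : tensor (u + u') v = tensor u v + tensor u' v.
Proof. by have := tensor_bilin.1 v 1 u u'; rewrite /= !scale1r. Qed.
Lemma tensorDr u v v' : tensor u (v + v') = tensor u v + tensor u v'.
Proof. by have := tensor_bilin.2 u 1 v v'; rewrite /= !scale1r. Qed.
Lemma tensor0l v : tensor 0 v = 0.
Proof. by apply: (addrI (tensor 0 v)); rewrite -tensorDl !addr0. Qed.
Lemma tensor0r u : tensor u 0 = 0.
Proof. by apply: (addrI (tensor u 0)); rewrite -tensorDr !addr0. Qed.
Lemma tensorZl a u v : tensor (a *: u) v = a *: tensor u v.
Proof. by have := tensor_bilin.1 v a u 0; rewrite /= tensor0l !addr0. Qed.
Lemma tensorZr a u v : tensor u (a *: v) = a *: tensor u v.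
Proof. by have := tensor_bilin.2 u a v 0; rewrite /= tensor0r !addr0. Qed.

Lemma tens_ind (P : tens -> Prop) :
    (forall u v, P (tensor u v)) ->
    (forall a x y, P x -> P y -> P (a *: x + y)) ->
  forall x, P x.
Proof.
move=> hu hD x; rewrite -[x]reprK -[repr x]freeg_sumE.
have P0 : P 0.
  have := hD (-1) _ _ (hu 0 0) (hu 0 0).
  by rewrite tensor0l scaler0 addr0.
elim: (dom _) => [|[u v] s IH]; first by rewrite big_nil.
have E a : << a *g (u, v) >> = a *: << (u, v) >> :> free.
  by apply/eqP/freeg_eqP => z; rewrite coeffZ !coeffU mul1r.
by rewrite big_cons E pi_linear; apply: hD => //; apply: hu.
Qed.

Lemma tens_ext (W : lmodType k) (f g : {linear tens -> W}) :
  (forall u v, f (tensor u v) = g (tensor u v)) -> f =1 g.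
Proof.
by move=> e; elim/tens_ind => [//|a x y hx hy]; rewrite !linearP hx hy.
Qed.

Section Lift.
Context (W : lmodType k) (f : U -> V -> W) (fP : bilin f).

Local Notation lift0 := (fglift (fun uv => f uv.1 uv.2)).

Lemma fglift_linear : linear (lift0 : free -> W).
Proof.
have A : zmod_morphism (lift0 : free -> W) by exact: lift_is_additive.
pose h := GRing.isZmodMorphism.Build _ _ (lift0 : free -> W) A.
pose L : {additive free -> W} := HB.pack (lift0 : free -> W) h.
have Z a x : lift0 (a *: x) = a *: lift0 x.
  rewrite -[x]freeg_sumE scaler_sumr -![lift0 _]/(L _) !raddf_sum.
  apply: eq_bigr => z _ /=.
  have -> : a *: << coeff z x *g z >> = << a * coeff z x *g z >>.
    by apply/eqP/freeg_eqP => t; rewrite coeffZ !coeffU mulrA.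
  by rewrite !liftU scalerA.
by move=> a x y; rewrite -[LHS]/(L _) raddfD /= Z.
Qed.

Lemma fglift_relations x : bilinear_relations x -> lift0 x = 0.
Proof.
pose h := GRing.isLinear.Build _ _ _ _ (lift0 : free -> W) fglift_linear.
pose L : {linear free -> W} := HB.pack (lift0 : free -> W) h.
rewrite -[lift0 x]/(L x).
elim=> {x} [|a x y _ hx _ hy|a u u' v|a u v v'].
- exact: raddf0.
- by rewrite linearP hx hy scaler0 addr0.
- rewrite linearB linearP /= !liftU !scale1r /=.
  by have /= -> := fP.1 v a u u'; rewrite subrr.
- rewrite linearB linearP /= !liftU !scale1r /=.
  by have /= -> := fP.2 u a v v'; rewrite subrr.
Qed.

Lemma fglift_pi x : lift0 (repr (\pi_tens_type x)) = lift0 x.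
Proof.
apply/eqP; rewrite -subr_eq0; apply/eqP.
have := fglift_relations (tens_reprK x).
by rewrite -[_ - x]addrC -scaleN1r fglift_linear scaleN1r addrC.
Qed.

Definition tens_lift_fun (x : tens) : W := lift0 (repr x).

Lemma tens_lift_linear : linear tens_lift_fun.
Proof.
move=> a x y; rewrite /tens_lift_fun -[x]reprK -[y]reprK -pi_linear.
by rewrite !fglift_pi fglift_linear.
Qed.

Lemma tens_lift_exists :
  {g : {linear tens -> W} | forall u v, g (tensor u v) = f u v}.
Proof.
pose L : {linear tens -> W} := HB.pack tens_lift_fun
  (GRing.isLinear.Build k tens W _ tens_lift_fun tens_lift_linear).
exists L => u v /=.
by rewrite /tens_lift_fun fglift_pi liftU scale1r.
Qed.

Definition tens_lift : {linear tens -> W} := sval tens_lift_exists.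

Lemma tens_liftE u v : tens_lift (tensor u v) = f u v.
Proof. exact: (svalP tens_lift_exists). Qed.

End Lift.

End TensorProduct.

Section TensorMaps.
Context (k : fieldType).
Implicit Types U V W X : lmodType k.

Lemma bilin_tensl U V W X (f : tens U V -> W -> X) :
    (forall w, linear (f^~ w)) -> (forall u v, linear (f (tensor u v))) ->
  bilin f.
Proof.
move=> hl hr; split=> // x a w w'; elim/tens_ind: x => [u v|b x y hx hy].
  exact: hr.
by rewrite !hl hx hy !scalerDr !scalerA addrACA (mulrC a b).
Qed.

Lemma bilin_tensr U V W X (f : W -> tens U V -> X) :
    (forall w, linear (f w)) -> (forall u v, linear (f^~ (tensor u v))) ->
  bilin f.
Proof.
move=> hl hr; split=> // x a w w'; elim/tens_ind: x => [u v|b x y hx hy].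
  exact: hr.
by rewrite !hl hx hy !scalerDr !scalerA addrACA (mulrC a b).
Qed.

Lemma tmap_bilin U V W X (f : {linear U -> W}) (g : {linear V -> X}) :
  bilin (fun u v => tensor (f u) (g v)).
Proof.
by split=> [v a u u'|u a v v'] /=;
   rewrite linearP (tensorDl, tensorDr) (tensorZl, tensorZr).
Qed.
Definition tmap U V W X (f : {linear U -> W}) (g : {linear V -> X})
  : {linear tens U V -> tens W X} := tens_lift (tmap_bilin f g).
Lemma tmapE U V W X (f : {linear U -> W}) (g : {linear V -> X}) u v :
  tmap f g (tensor u v) = tensor (f u) (g v).
Proof. exact: tens_liftE. Qed.

Lemma tswap_bilin U V : bilin (fun (u : U) (v : V) => tensor v u).
Proof.
by split=> [v|u]; [apply: (tensor_bilin V U).2 | apply: (tensor_bilin V U).1].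
Qed.
Definition tswap U V : {linear tens U V -> tens V U} := tens_lift (tswap_bilin U V).
Lemma tswapE U V (u : U) (v : V) : tswap U V (tensor u v) = tensor v u.
Proof. exact: tens_liftE. Qed.

Lemma tassoc_bilin1 U V W (w : W) :
  bilin (fun (u : U) (v : V) => tensor u (tensor v w)).
Proof.
by split=> [v a u u'|u a v v'] /=;
   rewrite ?(tensorDl, tensorZl) ?(tensorDr, tensorZr).
Qed.
Lemma tassoc_bilin U V W :
  bilin (fun (x : tens U V) (w : W) => tens_lift (tassoc_bilin1 U V w) x).
Proof.
apply: bilin_tensl => [w|u v] a x y; first by rewrite linearP.
by rewrite !tens_liftE !(tensorDr, tensorZr).
Qed.
Definition tassoc U V W : {linear tens (tens U V) W -> tens U (tens V W)} :=
  tens_lift (tassoc_bilin U V W).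
Lemma tassocE U V W (u : U) (v : V) (w : W) :
  tassoc U V W (tensor (tensor u v) w) = tensor u (tensor v w).
Proof. by rewrite !tens_liftE. Qed.

Lemma tassocV_bilin1 U V W (u : U) :
  bilin (fun (v : V) (w : W) => tensor (tensor u v) w).
Proof.
by split=> [w a v v'|v a w w'] /=;
   rewrite ?(tensorDr, tensorZr) ?(tensorDl, tensorZl).
Qed.
Lemma tassocV_bilin U V W :
  bilin (fun (u : U) (x : tens V W) => tens_lift (tassocV_bilin1 V W u) x).
Proof.
apply: bilin_tensr => [w|u v] a x y; first by rewrite linearP.
by rewrite !tens_liftE !(tensorDl, tensorZl).
Qed.
Definition tassocV U V W : {linear tens U (tens V W) -> tens (tens U V) W} :=
  tens_lift (tassocV_bilin U V W).
Lemma tassocVE U V W (u : U) (v : V) (w : W) :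
  tassocV U V W (tensor u (tensor v w)) = tensor (tensor u v) w.
Proof. by rewrite !tens_liftE. Qed.

Definition tmid U V W X :
    {linear tens (tens U V) (tens W X) -> tens (tens U W) (tens V X)} :=
  tassocV U W (tens V X)
  \o tmap idfun (tassoc W V X \o tmap (tswap V W) idfun \o tassocV V W X)
  \o tassoc U V (tens W X).
Lemma tmidE U V W X (u : U) (v : V) (w : W) (x : X) :
  tmid U V W X (tensor (tensor u v) (tensor w x))
  = tensor (tensor u w) (tensor v x).
Proof.
rewrite /tmid /= tassocE tmapE /= tassocVE tmapE /= tswapE tassocE.
by rewrite tassocVE.
Qed.

Lemma tlunit_bilin U : bilin (fun (a : k^o) (u : U) => a *: u).
Proof.
split=> [u a b c|a b u v]; first by rewrite scalerDl scalerA.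
by rewrite scalerDr !scalerA mulrC.
Qed.
Definition tlunit U : {linear tens k^o U -> U} := tens_lift (tlunit_bilin U).
Lemma trunit_bilin U : bilin (fun (u : U) (a : k^o) => a *: u).
Proof.
by split=> [a|u]; [apply: (tlunit_bilin U).2 | apply: (tlunit_bilin U).1].
Qed.
Definition trunit U : {linear tens U k^o -> U} := tens_lift (trunit_bilin U).
Lemma tlunitE U a (u : U) : tlunit U (tensor a u) = a *: u.
Proof. exact: tens_liftE. Qed.
Lemma trunitE U a (u : U) : trunit U (tensor u a) = a *: u.
Proof. exact: tens_liftE. Qed.

End TensorMaps.

(* A functor on finite sets and bijections: [sp_map] is indexed by a proof of
   bijectivity, on which, by [sp_map_id] and [sp_map_comp], it does not depend. *)
Record species (k : fieldType) := Species {
  sp_obj :> finType -> lmodType k;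
  sp_map : forall (A B : finType) (s : A -> B),
    bijective s -> {linear sp_obj A -> sp_obj B};
  sp_map_id : forall (A : finType) (e : bijective (@id A)) x, sp_map e x = x;
  sp_map_comp : forall (A B C : finType) (s : A -> B) (t : B -> C)
    (es : bijective s) (et : bijective t) (ets : bijective (t \o s)) x,
    sp_map ets x = sp_map et (sp_map es x)
}.

(* The finite sets carrying products and coproducts are subsets of an
   arbitrary ambient [finType], viewed as objects of the category of finite
   sets through [elts]; thus blocks of a decomposition are actual subsets. *)
Definition elts (K : finType) (S : {set K}) : finType := {x : K | x \in S}.

Definition splits (K : finType) (I S T : {set K}) : bool :=
  (S :|: T == I) && [disjoint S & T].

(* [s] sends S into S' and restricts there to [sS]. *)
Definition restricts (K L : finType) (I S : {set K}) (I' S' : {set L})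
    (s : elts I -> elts I') (sS : elts S -> elts S') : Prop :=
  forall (x : elts S) (y : elts I), val x = val y -> val (sS x) = val (s y).

Section Structures.
Context (k : fieldType) (p : species k).

Record monoid_on := MonoidOn {
  mon_mul : forall (K : finType) (I S T : {set K}), splits I S T ->
    {linear tens (p (elts S)) (p (elts T)) -> p (elts I)};
  mon_unit : forall K : finType, {linear k^o -> p (elts (set0 : {set K}))};
  mon_mul_natural : forall (K L : finType)
    (I S T : {set K}) (I' S' T' : {set L})
    (e : splits I S T) (e' : splits I' S' T')
    (s : elts I -> elts I') (sS : elts S -> elts S') (sT : elts T -> elts T')
    (es : bijective s) (eS : bijective sS) (eT : bijective sT),
    restricts s sS -> restricts s sT -> forall x,
    sp_map p es (mon_mul e x)
    = mon_mul e' (tmap (sp_map p eS) (sp_map p eT) x);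
  mon_unit_natural : forall (K L : finType)
    (s : elts (set0 : {set K}) -> elts (set0 : {set L})) (es : bijective s) a,
    sp_map p es (mon_unit K a) = mon_unit L a;
  mon_assoc : forall (K : finType) (I R S T RS ST : {set K})
    (eRS : splits RS R S) (eST : splits ST S T)
    (e1 : splits I RS T) (e2 : splits I R ST) x,
    mon_mul e1 (tmap (mon_mul eRS) idfun x)
    = mon_mul e2 (tmap idfun (mon_mul eST) (tassoc _ _ _ x));
  mon_unitl : forall (K : finType) (I : {set K}) (e : splits I set0 I) x,
    mon_mul e (tmap (mon_unit K) idfun x) = tlunit _ x;
  mon_unitr : forall (K : finType) (I : {set K}) (e : splits I I set0) x,
    mon_mul e (tmap idfun (mon_unit K) x) = trunit _ x
}.

Record comonoid_on := ComonoidOn {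
  com_comul : forall (K : finType) (I S T : {set K}), splits I S T ->
    {linear p (elts I) -> tens (p (elts S)) (p (elts T))};
  com_counit : forall K : finType, {linear p (elts (set0 : {set K})) -> k^o};
  com_comul_natural : forall (K L : finType)
    (I S T : {set K}) (I' S' T' : {set L})
    (e : splits I S T) (e' : splits I' S' T')
    (s : elts I -> elts I') (sS : elts S -> elts S') (sT : elts T -> elts T')
    (es : bijective s) (eS : bijective sS) (eT : bijective sT),
    restricts s sS -> restricts s sT -> forall x,
    com_comul e' (sp_map p es x)
    = tmap (sp_map p eS) (sp_map p eT) (com_comul e x);
  com_counit_natural : forall (K L : finType)
    (s : elts (set0 : {set K}) -> elts (set0 : {set L})) (es : bijective s) x,
    com_counit L (sp_map p es x) = com_counit K x;
  com_coassoc : forall (K : finType) (I R S T RS ST : {set K})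
    (eRS : splits RS R S) (eST : splits ST S T)
    (e1 : splits I RS T) (e2 : splits I R ST) x,
    tassoc _ _ _ (tmap (com_comul eRS) idfun (com_comul e1 x))
    = tmap idfun (com_comul eST) (com_comul e2 x);
  com_counitl : forall (K : finType) (I : {set K}) (e : splits I set0 I) x,
    tlunit _ (tmap (com_counit K) idfun (com_comul e x)) = x;
  com_counitr : forall (K : finType) (I : {set K}) (e : splits I I set0) x,
    trunit _ (tmap idfun (com_counit K) (com_comul e x)) = x
}.

End Structures.

(* In [bim_mul_comul], S = A + B, T = C + D, S' = A + C and T' = B + D force
   A, B, C, D to be the four pairwise intersections.  The four compatibility
   axioms say that the product and the unit are morphisms of comonoids. *)
Record bimonoid (k : fieldType) := Bimonoid {
  bim_species :> species k;
  bim_monoid : monoid_on bim_species;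
  bim_comonoid : comonoid_on bim_species;
  bim_mul_comul : forall (K : finType) (I S T S' T' A B C D : {set K})
    (e : splits I S T) (e' : splits I S' T')
    (eS : splits S A B) (eT : splits T C D)
    (eS' : splits S' A C) (eT' : splits T' B D) x,
    com_comul bim_comonoid e' (mon_mul bim_monoid e x)
    = tmap (mon_mul bim_monoid eS') (mon_mul bim_monoid eT')
        (tmid _ _ _ _
          (tmap (com_comul bim_comonoid eS) (com_comul bim_comonoid eT) x));
  bim_mul_counit : forall (K : finType)
    (e : splits (set0 : {set K}) set0 set0) x,
    com_counit bim_comonoid K (mon_mul bim_monoid e x)
    = tlunit k^o
        (tmap (com_counit bim_comonoid K) (com_counit bim_comonoid K) x);
  bim_unit_comul : forall (K : finType)
    (e : splits (set0 : {set K}) set0 set0),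
    com_comul bim_comonoid e (mon_unit bim_monoid K 1)
    = tensor (mon_unit bim_monoid K 1) (mon_unit bim_monoid K 1);
  bim_unit_counit : forall (K : finType) a,
    com_counit bim_comonoid K (mon_unit bim_monoid K a) = a
}.

Section Bimonoids.
Context (k : fieldType) (h : bimonoid k).

Definition mu (K : finType) (I S T : {set K}) (e : splits I S T)
  : {linear tens (h (elts S)) (h (elts T)) -> h (elts I)} :=
  mon_mul (bim_monoid h) e.
Definition iota0 (K : finType) : {linear k^o -> h (elts (set0 : {set K}))} :=
  mon_unit (bim_monoid h) K.
Definition Delta (K : finType) (I S T : {set K}) (e : splits I S T)
  : {linear h (elts I) -> tens (h (elts S)) (h (elts T))} :=
  com_comul (bim_comonoid h) e.
Definition epsilon0 (K : finType) : {linear h (elts (set0 : {set K})) -> k^o} :=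
  com_counit (bim_comonoid h) K.

Definition commutative_bimonoid : Prop :=
  forall (K : finType) (I S T : {set K}) (e : splits I S T) (e' : splits I T S)
    (x : h (elts S)) (y : h (elts T)), mu e (tensor x y) = mu e' (tensor y x).

Definition cocommutative_bimonoid : Prop :=
  forall (K : finType) (I S T : {set K}) (e : splits I S T) (e' : splits I T S)
    (x : h (elts I)), tswap _ _ (Delta e x) = Delta e' x.

End Bimonoids.

Section Decompositions.
Context (K : finType).
Implicit Types (I S : {set K}) (F G : seq {set K}).

Definition is_decomp I F : bool :=
  pairwise (fun S T : {set K} => [disjoint S & T]) F
  && (\bigcup_(S <- F) S == I).

Lemma is_decomp_nil I : is_decomp I [::] -> set0 = I.
Proof. by case/andP => _ /eqP <-; rewrite big_nil. Qed.

Lemma is_decomp_one I S : is_decomp I [:: S] -> S = I.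
Proof. by case/andP => _ /eqP <-; rewrite big_seq1. Qed.

Lemma is_decomp_splits I S F :
  is_decomp I (S :: F) -> splits I S (\bigcup_(T <- F) T).
Proof.
case/andP => /= /andP[/allP dS _] /eqP <-; rewrite /splits big_cons eqxx /=.
rewrite big_seq; elim/big_ind: _ => [|A B dA dB|T /dS //].
- by rewrite -setI_eq0 setI0.
- by rewrite -setI_eq0 setIUr setU_eq0 !setI_eq0 dA.
Qed.

Lemma is_decomp_behead I S F :
  is_decomp I (S :: F) -> is_decomp (\bigcup_(T <- F) T) F.
Proof. by case/andP => /= /andP[_ dF] _; rewrite /is_decomp dF eqxx. Qed.

(* Blocks may be empty and repeated empty blocks count, so [decomp I] is
   infinite: disjointness is required between positions, not between values. *)
Record decomp I := Decomp {
  blocks :> seq {set K};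
  blocksP : is_decomp I blocks
}.
HB.instance Definition _ I := [isSub for @blocks I].
HB.instance Definition _ I := [Choice of decomp I by <:].

Lemma is_decomp_one_block I : is_decomp I [:: I].
Proof. by rewrite /is_decomp /= big_seq1. Qed.
Definition one_block I : decomp I := Decomp (is_decomp_one_block I).

(* All intersections, F-major: (A_1 B_1, A_1 B_2, ..., A_2 B_1, ...). *)
Definition tits_blocks F G : seq {set K} := [seq A :&: B | A <- F, B <- G].

Lemma tits_blocksP I (F G : decomp I) : is_decomp I (tits_blocks F G).
Proof.
case: F G => [F /andP[dF /eqP uF]] [G /andP[dG /eqP uG]] /=.
have disjII (A B C D : {set K}) :
    [disjoint A & C] || [disjoint B & D] -> [disjoint A :&: B & C :&: D].
  by rewrite -!setI_eq0 setIACA => /orP[] /eqP ->; rewrite ?set0I ?setI0.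
apply/andP; split; last first.
  rewrite /tits_blocks big_allpairs_dep; apply/eqP.
  under eq_bigr do rewrite -big_distrr /= uG.
  by rewrite -big_distrl /= uF setIid.
elim: F dF {uF} => //= S F IH /andP[/allP dS dF].
rewrite /tits_blocks allpairs_cons pairwise_cat IH // andbT; apply/andP; split.
  apply/allrelP => _ _ /mapP[T _ ->] /allpairsP[[S' T'] /= [S'F _ ->]].
  by rewrite disjII ?dS.
rewrite pairwise_map; apply: sub_pairwise dG => T T' /= dT.
by rewrite disjII ?dT ?orbT.
Qed.
Definition tits_decomp I (F G : decomp I) : decomp I := Decomp (tits_blocksP F G).

End Decompositions.

Section HigherOperations.
Context (k : fieldType) (h : bimonoid k) (K : finType).
Implicit Types (I S : {set K}) (F : seq {set K}).

(* h(I_1, ..., I_k) = h[I_1] (x) (h[I_2] (x) (... (x) h[I_k])); a single block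
   gives h[I_1] itself, so that the higher operations are identities there. *)
Fixpoint tens_blocks F : lmodType k :=
  match F with
  | [::] => k^o
  | B :: F' => match F' with
               | [::] => h (elts B)
               | _ :: _ => tens (h (elts B)) (tens_blocks F')
               end
  end.

(* Transport along an equality of subsets; it is the identity when S is I. *)
Definition castS S I (e : S = I) : {linear h (elts S) -> h (elts I)} :=
  let: erefl := e in idfun.

Fixpoint higher_mu F :
    forall I, is_decomp I F -> {linear tens_blocks F -> h (elts I)} :=
  match F return forall I, is_decomp I F -> {linear tens_blocks F -> h (elts I)} with
  | [::] => fun I e => castS (is_decomp_nil e) \o iota0 h K
  | B :: F' =>
    match F' return
      (forall I, is_decomp I F' -> {linear tens_blocks F' -> h (elts I)}) ->
      forall I, is_decomp I (B :: F') -> {linear tens_blocks (B :: F') -> h (elts I)}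
    with
    | [::] => fun _ I e => castS (is_decomp_one e)
    | _ :: _ => fun mu' I e =>
        mu h (is_decomp_splits e) \o tmap idfun (mu' _ (is_decomp_behead e))
    end (@higher_mu F')
  end.

Fixpoint higher_Delta F :
    forall I, is_decomp I F -> {linear h (elts I) -> tens_blocks F} :=
  match F return forall I, is_decomp I F -> {linear h (elts I) -> tens_blocks F} with
  | [::] => fun I e => epsilon0 h K \o castS (esym (is_decomp_nil e))
  | B :: F' =>
    match F' return
      (forall I, is_decomp I F' -> {linear h (elts I) -> tens_blocks F'}) ->
      forall I, is_decomp I (B :: F') -> {linear h (elts I) -> tens_blocks (B :: F')}
    with
    | [::] => fun _ I e => castS (esym (is_decomp_one e))
    | _ :: _ => fun Delta' I e =>
        tmap idfun (Delta' _ (is_decomp_behead e)) \o Delta h (is_decomp_splits e)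
    end (@higher_Delta F')
  end.

End HigherOperations.

(* [{freeg D / k}] is the free k-vector space on the basis D. *)
Definition hSigma (k : fieldType) (K : finType) (I : {set K}) : lmodType k :=
  {freeg (decomp I) / k}.

(* The basis vector H_F. *)
Definition basisH (k : fieldType) (K : finType) (I : {set K}) (F : decomp I)
  : hSigma k I := << F >>.

Definition char_op (k : fieldType) (h : bimonoid k) (K : finType) (I : {set K})
    (z : hSigma k I) (x : h (elts I)) : h (elts I) :=
  \sum_(F <- dom z)
    coeff F z *: higher_mu h (blocksP F) (higher_Delta h (blocksP F) x).

(* The bilinear extension of H_F, H_G |-> H_FG. *)
Definition tits (k : fieldType) (K : finType) (I : {set K})
    (z w : hSigma k I) : hSigma k I :=
  \sum_(F <- dom z) \sum_(G <- dom w)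
    (coeff F z * coeff G w) *: basisH k (tits_decomp F G).

(* Main.v *)
(* Write op_F = mu_F Delta_F.  Under the convolution f * g = mu (f (x) g) Delta,
   which is associative, op_(S_1, ..., S_p) = id_(S_1) * ... * id_(S_p).  If h
   is cocommutative, the compatibility of mu and Delta makes op_G commute with
   coproducts: Delta_{S,T} op_G = (op_{G|S} (x) op_{G|T}) Delta_{S,T}.  Hence
   op_(S :: F) op_G = op_{G|S} * (op_F op_{G|T}), where T is the union of F, and
   induction on F gives op_F op_G = op_{FG}.  The commutative case is dual, from
   op_G mu_{S,T} = mu_{S,T} (op_{G|S} (x) op_{G|T}). *)
Require Import Defs.
From HB Require Import structures.
From mathcomp Require Import all_boot all_order all_algebra.

Set Implicit Arguments.
Unset Strict Implicit.
Unset Printing Implicit Defensive.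

Import GRing.Theory.
Local Open Scope ring_scope.

(** * Functoriality of the tensor product and naturality of its structure maps *)

Section TensorIdentities.
Context (k : fieldType).
Implicit Types U V W X Y Z : lmodType k.

Lemma eq_tmap U V W X (f f' : {linear U -> W}) (g g' : {linear V -> X}) :
  f =1 f' -> g =1 g' -> tmap f g =1 tmap f' g'.
Proof. by move=> ef eg; apply: tens_ext => u v; rewrite !tmapE ef eg. Qed.

Lemma tmap_comp U V W X Y Z (f : {linear U -> W}) (g : {linear V -> X})
    (f' : {linear W -> Y}) (g' : {linear X -> Z}) x :
  tmap f' g' (tmap f g x) = tmap (f' \o f) (g' \o g) x.
Proof.
by rewrite -[LHS]/((tmap f' g' \o tmap f g) x); move: x;
   apply: tens_ext => u v; rewrite /= !tmapE.
Qed.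

Lemma tmap_id U V (f : {linear U -> U}) (g : {linear V -> V}) :
  f =1 id -> g =1 id -> tmap f g =1 id.
Proof.
move=> ef eg x; rewrite -[RHS]/((idfun : {linear _ -> _}) x).
by move: x; apply: tens_ext => u v; rewrite tmapE ef eg.
Qed.

Lemma tassocK U V W : cancel (@tassoc k U V W) (@tassocV k U V W).
Proof.
move=> x; elim/tens_ind: x => [x w|a x y hx hy]; last by rewrite !linearP hx hy.
elim/tens_ind: x => [u v|a x y hx hy]; first by rewrite tassocE tassocVE.
by rewrite tensorDl tensorZl !linearP hx hy.
Qed.

Lemma tassocVK U V W : cancel (@tassocV k U V W) (@tassoc k U V W).
Proof.
move=> x; elim/tens_ind: x => [u x|a x y hx hy]; last by rewrite !linearP hx hy.
elim/tens_ind: x => [v w|a x y hx hy]; first by rewrite tassocVE tassocE.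
by rewrite tensorDr tensorZr !linearP hx hy.
Qed.

Lemma tassoc_tmap U V W U' V' W' (f : {linear U -> U'}) (g : {linear V -> V'})
    (l : {linear W -> W'}) x :
  tassoc _ _ _ (tmap (tmap f g) l x) = tmap f (tmap g l) (tassoc _ _ _ x).
Proof.
elim/tens_ind: x => [x w|a x y hx hy]; last by rewrite !linearP hx hy.
elim/tens_ind: x => [u v|a x y hx hy]; first by rewrite !(tmapE, tassocE).
by rewrite tensorDl tensorZl !linearP hx hy.
Qed.

Lemma tassocV_tmap U V W U' V' W' (f : {linear U -> U'}) (g : {linear V -> V'})
    (l : {linear W -> W'}) x :
  tassocV _ _ _ (tmap f (tmap g l) x) = tmap (tmap f g) l (tassocV _ _ _ x).
Proof. by rewrite -{1}[x]tassocVK -tassoc_tmap tassocK. Qed.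

Lemma tmid_tmap U V W X U' V' W' X' (f : {linear U -> U'})
    (g : {linear V -> V'}) (l : {linear W -> W'}) (m : {linear X -> X'}) x :
  tmid _ _ _ _ (tmap (tmap f g) (tmap l m) x)
  = tmap (tmap f l) (tmap g m) (tmid _ _ _ _ x).
Proof.
elim/tens_ind: x => [x y|a x y hx hy]; last by rewrite !linearP hx hy.
elim/tens_ind: x => [u v|a x z hx hy]; last first.
  by rewrite tensorDl tensorZl !linearP hx hy.
elim/tens_ind: y => [w z|a y z hx hy]; last first.
  by rewrite tensorDr tensorZr !linearP hx hy.
by rewrite !(tmapE, tmidE).
Qed.

Lemma tlunit_tmap U V (f : {linear U -> V}) x :
  tlunit V (tmap idfun f x) = f (tlunit U x).
Proof.
elim/tens_ind: x => [a u|a x y hx hy]; last by rewrite !linearP hx hy.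
by rewrite tmapE !tlunitE linearZ.
Qed.

Lemma trunit_tmap U V (f : {linear U -> V}) x :
  trunit V (tmap f idfun x) = f (trunit U x).
Proof.
elim/tens_ind: x => [u a|a x y hx hy]; last by rewrite !linearP hx hy.
by rewrite tmapE !trunitE linearZ.
Qed.

(** Every element of k (x) k is 1 (x) its image in k, so identities in k (x) k may be checked in
    k. *)
Lemma tlunit_inj : injective (tlunit (k^o : lmodType k)).
Proof.
have E (x : tens k^o k^o) : x = tensor (1 : k^o) (tlunit (k^o : lmodType k) x).
  elim/tens_ind: x => [a u|a x y hx hy].
    by rewrite tlunitE tensorZr -tensorZl; congr tensor;
      rewrite /GRing.scale /= mulr1.
  by rewrite linearP tensorDr tensorZr -hx -hy.
by move=> x y e; rewrite [x]E [y]E e.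
Qed.

End TensorIdentities.

(** * Two-block splittings and restriction of decompositions *)

Section Splits.
Context (K : finType).
Implicit Types (I R S T ST A B : {set K}) (F G : seq {set K}).

Lemma splitsP I S T :
  reflect
    (forall x, (x \in I = (x \in S) || (x \in T))
      /\ ~~ ((x \in S) && (x \in T)))
    (splits I S T).
Proof.
apply: (iffP andP) => [[/eqP <- d] x|e].
  by rewrite inE; split => //; apply/andP=> -[xS]; rewrite (disjointFr d xS).
split; first by apply/eqP/setP => x; rewrite inE (e x).1.
by rewrite -setI_eq0; apply/eqP/setP => x; rewrite !inE (negPf (e x).2).
Qed.

(** The union of the tail becomes a variable T, so that inductions on decompositions can treat the
    tail as a decomposition of an arbitrary set. *)
Lemma decomp_consP I S F :
  reflect (exists2 T, splits I S T & is_decomp T F) (is_decomp I (S :: F)).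
Proof.
apply: (iffP idP) => [e|[T /andP[/eqP <- d] /andP[pF /eqP eT]]].
  by exists (\bigcup_(T <- F) T);
    [apply: is_decomp_splits | apply: is_decomp_behead e].
rewrite /is_decomp big_cons eT eqxx andbT /= pF andbT; apply/allP => A AF.
by apply: disjointWr d; rewrite -eT bigcup_seq (bigcup_sup A).
Qed.

Lemma decomp_sub I F A : is_decomp I F -> A \in F -> A \subset I.
Proof. by move=> /andP[_ /eqP <-] AF; rewrite bigcup_seq (bigcup_sup A). Qed.

Lemma decomp_nilP I : reflect (I = set0) (is_decomp I [::]).
Proof.
apply: (iffP idP) => [/is_decomp_nil //|->].
by rewrite /is_decomp big_nil eqxx.
Qed.

Lemma splits_setI I S T A : splits I S T -> A \subset I ->
  splits A (S :&: A) (T :&: A).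
Proof.
move/splitsP => e /subsetP AI; apply/splitsP => x; rewrite !inE.
have := e x; case: (boolP (x \in A)) => [/AI ->|_ _]; last by rewrite !andbF.
by rewrite !andbT => -[<-].
Qed.

Lemma splitsC I S T : splits I S T -> splits I T S.
Proof. by rewrite /splits setUC disjoint_sym. Qed.

Lemma splits_subl I S T : splits I S T -> S \subset I.
Proof. by case/andP => /eqP <- _; apply: subsetUl. Qed.

Lemma splits_subr I S T : splits I S T -> T \subset I.
Proof. by move/splitsC/splits_subl. Qed.

Lemma splits_assoc I R S T ST :
  splits I R ST -> splits ST S T ->
  splits I (R :|: S) T /\ splits (R :|: S) R S.
Proof.
move=> /splitsP e1 /splitsP e2; split; apply/splitsP => x; move: (e1 x) (e2 x);
  rewrite !inE;
  case: (x \in I); case: (x \in R); case: (x \in S); case: (x \in T);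
  by case: (x \in ST) => //= -[? ?] [? ?].
Qed.

(** M and N are the intermediate unions met when A, B, C, D is reordered to A, C, B, D: A is
    detached, then B and C are grouped so that a single exchange inside N does the reordering. *)
Lemma splits_shuffle I S T T' A B C D :
  splits I S T -> splits S A B -> splits T C D -> splits T' B D ->
  exists M N, [/\ splits I A M /\ splits M B T,
    [/\ splits M N D, splits N B C & splits N C B] & splits M C T'].
Proof.
move=> e eS eT eT'; exists (T :|: B), (B :|: C).
have [/splitsC eAM /splitsC eM] := splits_assoc (splitsC e) (splitsC eS).
have [eMD eN] := splits_assoc eM eT; have eN' := splitsC eN.
have [eMC _] := splits_assoc (splitsC eMD) eN.
split=> //; apply: splitsC.
by case/andP: eT' => /eqP <- _; rewrite (setUC B D).
Qed.

(** This is F|S. Empty intersections are kept, so that the blocks of the Tits product of [A :: F]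
    with G are exactly [restrict A G] followed by [tits_blocks F G]. *)
Definition restrict S F := [seq S :&: A | A <- F].

Lemma restrict_setI S T F :
  is_decomp T F -> restrict S F = restrict (S :&: T) F.
Proof.
move=> eF; apply/eq_in_map => A /(decomp_sub eF)/setIidPr AT.
by rewrite -setIA AT.
Qed.

Lemma restrict_decomp I S F :
  S \subset I -> is_decomp I F -> is_decomp S (restrict S F).
Proof.
move=> sSI; elim: F I S sSI => [|A F IH] I S sSI.
  by move=> /decomp_nilP I0; apply/decomp_nilP/eqP; rewrite -subset0 -I0.
case/decomp_consP=> T e eF.
rewrite -[restrict S _]/(S :&: A :: restrict S F); apply/decomp_consP.
exists (S :&: T).
  by have := splits_setI e sSI; rewrite !(setIC _ S).
by rewrite (restrict_setI _ eF); apply: IH eF; apply: subsetIr.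
Qed.

Lemma cat_decomp I S T F G :
  splits I S T -> is_decomp S F -> is_decomp T G -> is_decomp I (F ++ G).
Proof.
elim: F I S => [|A F IH] I S e.
  move=> /decomp_nilP S0; move: e; rewrite S0 => /andP[/eqP <- _].
  by rewrite set0U.
case/decomp_consP => B eS eF eG.
have [e1 e2] := splits_assoc (splitsC e) (splitsC eS).
apply/decomp_consP; exists (T :|: B); first exact: splitsC.
by apply: IH eF eG; apply: splitsC.
Qed.

End Splits.

(** * Convolution of endomorphisms and its unit *)

Section Convolution.
Context (k : fieldType) (h : bimonoid k) (K : finType).
Implicit Types (I R S T RS ST A B : {set K}).

Local Notation "''End' S" := {linear h (elts S) -> h (elts S)}
  (at level 8, S at level 2).

Definition conv I S T (e : splits I S T) (f : 'End S) (g : 'End T) : 'End I :=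
  mu h e \o tmap f g \o Delta h e.

Lemma eq_conv I S T (e e' : splits I S T) (f f' : 'End S) (g g' : 'End T) :
  f =1 f' -> g =1 g' -> conv e f g =1 conv e' f' g'.
Proof.
by move=> ef eg x; rewrite /conv /= (eq_tmap ef eg) (bool_irrelevance e e').
Qed.

(** Associativity of the product and coassociativity of the coproduct rebracket the two ends;
    naturality of the associator carries f, g, l across. *)
Lemma convA I R S T RS ST (eRS : splits RS R S) (eST : splits ST S T)
    (e1 : splits I RS T) (e2 : splits I R ST) (f : 'End R) (g : 'End S)
    (l : 'End T) :
  conv e1 (conv eRS f g) l =1 conv e2 f (conv eST g l).
Proof.
move=> x; rewrite /conv /=.
have E1 y : tmap (mu h eRS \o tmap f g \o Delta h eRS) l y
    = tmap (mu h eRS) idfun (tmap (tmap f g) l (tmap (Delta h eRS) idfun y)).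
  by rewrite !tmap_comp; apply: eq_tmap.
have E2 y : tmap f (mu h eST \o tmap g l \o Delta h eST) y
    = tmap idfun (mu h eST) (tmap f (tmap g l) (tmap idfun (Delta h eST) y)).
  by rewrite !tmap_comp; apply: eq_tmap.
rewrite E1 E2 [LHS](mon_assoc _ _ eST _ e2) tassoc_tmap.
by rewrite [X in tmap f _ X](com_coassoc _ _ eST _ e2).
Qed.

(** The two-sided unit of convolution, and also op_F for the empty decomposition F. *)
Definition unit_counit : 'End (set0 : {set K}) := iota0 h K \o epsilon0 h K.

Lemma conv0f I (e : splits I set0 I) (f : 'End I) : conv e unit_counit f =1 f.
Proof.
move=> x; rewrite /conv /=.
have E y : tmap unit_counit f y
    = tmap (iota0 h K) idfun (tmap idfun f (tmap (epsilon0 h K) idfun y)).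
  by rewrite !tmap_comp; apply: eq_tmap.
rewrite E [LHS]mon_unitl tlunit_tmap; congr (f _).
exact: com_counitl.
Qed.

Lemma convf0 I (e : splits I I set0) (f : 'End I) : conv e f unit_counit =1 f.
Proof.
move=> x; rewrite /conv /=.
have E y : tmap f unit_counit y
    = tmap idfun (iota0 h K) (tmap f idfun (tmap idfun (epsilon0 h K) y)).
  by rewrite !tmap_comp; apply: eq_tmap.
rewrite E [LHS]mon_unitr trunit_tmap; congr (f _).
exact: com_counitr.
Qed.

(** After identifying k (x) k with k, this is the left counit law followed by the counit. *)
Lemma counit_counit_comul (e : splits (set0 : {set K}) set0 set0) x :
  tmap (epsilon0 h K) (epsilon0 h K) (Delta h e x)
  = tensor (epsilon0 h K x : k^o) (1 : k^o).
Proof.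
apply: tlunit_inj; rewrite tlunitE [RHS]mulr1.
rewrite -[in RHS](com_counitl (bim_comonoid h) e x) -tlunit_tmap.
by congr (tlunit _ _); rewrite tmap_comp; apply: eq_tmap.
Qed.

Lemma iota0E a : iota0 h K a = a *: iota0 h K 1.
Proof. by rewrite -linearZ /= /GRing.scale /= mulr1. Qed.

(** Both sides equal the counit of x times 1 (x) 1, with 1 the unit element, because the unit is a
    morphism of comonoids. This starts the induction in [comul_higher_op]. *)
Lemma comul_unit_counit (e : splits (set0 : {set K}) set0 set0) x :
  Delta h e (unit_counit x) = tmap unit_counit unit_counit (Delta h e x).
Proof.
rewrite /= -tmap_comp counit_counit_comul tmapE iota0E linearZ /=.
by rewrite [X in _ *: X](bim_unit_comul) -tensorZl -iota0E.
Qed.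

(** The counit is multiplicative, and multiplying by an image of the unit map is scaling. This
    starts the induction in [higher_op_mul]. *)
Lemma unit_counit_mul (e : splits (set0 : {set K}) set0 set0) x :
  unit_counit (mu h e x) = mu h e (tmap unit_counit unit_counit x).
Proof.
rewrite /= [X in iota0 h K X](bim_mul_counit) -tmap_comp.
elim/tens_ind: x => [u v|a x y hx hy]; last by rewrite !linearP hx hy.
rewrite !tmapE tlunitE.
have E a (b : h (elts (set0 : {set K}))) :
    mu h e (tensor (iota0 h K a) b) = a *: b.
  have := mon_unitl (bim_monoid h) e (tensor (a : k^o) b).
  by rewrite tmapE tlunitE.
by rewrite E linearZ.
Qed.

(** * Exchange of middle factors, and convolutions against coproducts and products *)

Lemma mulA I R S T RS ST (eRS : splits RS R S) (eST : splits ST S T)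
    (e1 : splits I RS T) (e2 : splits I R ST) u v w :
  mu h e1 (tensor (mu h eRS (tensor u v)) w)
  = mu h e2 (tensor u (mu h eST (tensor v w))).
Proof.
have := mon_assoc (bim_monoid h) eRS eST e1 e2 (tensor (tensor u v) w).
by rewrite tassocE !tmapE.
Qed.

(** Both sides are iterated coproducts into the same four blocks. Coassociativity isolates the
    coproduct of the union of B and C, where cocommutativity absorbs the exchange made by [tmid]. *)
Lemma comul_shuffle I S T S' T' A B C D : cocommutative_bimonoid h ->
  forall (e : splits I S T) (e' : splits I S' T') (eS : splits S A B)
    (eT : splits T C D) (eS' : splits S' A C) (eT' : splits T' B D) x,
  tmid _ _ _ _ (tmap (Delta h eS) (Delta h eT) (Delta h e x))
  = tmap (Delta h eS') (Delta h eT') (Delta h e' x).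
Proof.
move=> cc e e' eS eT eS' eT' x.
have [M [N [[eAM eM] [eMD eN eN'] eMC]]] := splits_shuffle e eS eT eT'.
rewrite /tmid /=.
have -> : tmap (Delta h eS) (Delta h eT) (Delta h e x)
    = tmap (tmap idfun idfun) (Delta h eT)
        (tmap (Delta h eS) idfun (Delta h e x)).
  by rewrite tmap_comp; apply: eq_tmap => // y /=; rewrite tmap_id.
rewrite tassoc_tmap [X in tmap _ _ X](com_coassoc _ _ eM _ eAM) !tmap_comp.
(* Inside M, splitting into B, C, D and exchanging B with C amounts to splitting into C, B, D;
   cocommutativity enters only at N. *)
have E : (tassoc _ _ _ \o tmap (tswap _ _) idfun \o tassocV _ _ _)
    \o (tmap idfun (Delta h eT) \o Delta h eM)
  =1 tmap idfun (Delta h eT') \o Delta h eMC.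
  move=> z /=; rewrite -(com_coassoc (bim_comonoid h) eN _ eMD) tassocK.
  rewrite tmap_comp -(com_coassoc (bim_comonoid h) eN' _ eMD).
  congr (tassoc _ _ _ _).
  by apply: eq_tmap => // y; apply: cc.
rewrite (eq_tmap (f' := idfun \o idfun) _ E) // -tmap_comp.
rewrite -[tmap idfun (com_comul _ _) _](com_coassoc _ eS' _ e').
rewrite tassocV_tmap tassocK tmap_comp.
by apply: eq_tmap => // y /=; rewrite tmap_id.
Qed.

Lemma mul_shuffle I S T S' T' A B C D : commutative_bimonoid h ->
  forall (e : splits I S T) (e' : splits I S' T') (eS : splits S A B)
    (eT : splits T C D) (eS' : splits S' A C) (eT' : splits T' B D) x,
  mu h e' (tmap (mu h eS') (mu h eT') (tmid _ _ _ _ x))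
  = mu h e (tmap (mu h eS) (mu h eT) x).
Proof.
move=> cc e e' eS eT eS' eT' x.
have [M [N [[eAM eM] [eMD eN eN'] eMC]]] := splits_shuffle e eS eT eT'.
elim/tens_ind: x => [x y|a x y hx hy]; last by rewrite !linearP hx hy.
elim/tens_ind: x => [u v|a x z hx hy]; last first.
  by rewrite tensorDl tensorZl !linearP hx hy.
elim/tens_ind: y => [w z|a y z hx hy]; last first.
  by rewrite tensorDr tensorZr !linearP hx hy.
rewrite tmidE !tmapE (mulA _ eMC _ eAM) -(mulA eN' _ eMD) (cc _ _ _ _ eN' eN).
by rewrite (mulA _ eT _ eM) -(mulA eS _ e).
Qed.

(** If f and g are compatible with coproducts, so is f * g: the bimonoid axiom moves the coproduct
    past the product, naturality of [tmid] regroups the four maps, and [comul_shuffle] recombines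
    the coproducts. *)
Lemma comul_conv I S T S' T' A B C D : cocommutative_bimonoid h ->
  forall (e : splits I S T) (e' : splits I S' T') (eS : splits S A B)
    (eT : splits T C D) (eS' : splits S' A C) (eT' : splits T' B D)
    (f : 'End S) (g : 'End T) (fA : 'End A) (fB : 'End B) (gC : 'End C)
    (gD : 'End D),
  (forall x, Delta h eS (f x) = tmap fA fB (Delta h eS x)) ->
  (forall x, Delta h eT (g x) = tmap gC gD (Delta h eT x)) ->
  forall x, Delta h e' (conv e f g x)
    = tmap (conv eS' fA gC) (conv eT' fB gD) (Delta h e' x).
Proof.
move=> cc e e' eS eT eS' eT' f g fA fB gC gD ef eg x.
rewrite {1}/conv /= [LHS](bim_mul_comul e e' eS eT eS' eT') tmap_comp.
rewrite (eq_tmap (f' := tmap fA fB \o Delta h eS)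
  (g' := tmap gC gD \o Delta h eT)) //.
rewrite -tmap_comp tmid_tmap (comul_shuffle cc e e' eS eT eS' eT').
by rewrite !tmap_comp.
Qed.

(** Dual to [comul_conv], with [mul_shuffle] recombining the products. *)
Lemma conv_mul I S T S' T' A B C D : commutative_bimonoid h ->
  forall (e : splits I S T) (e' : splits I S' T') (eS : splits S A B)
    (eT : splits T C D) (eS' : splits S' A C) (eT' : splits T' B D)
    (f : 'End S) (g : 'End T) (fA : 'End A) (fB : 'End B) (gC : 'End C)
    (gD : 'End D),
  (forall x, f (mu h eS x) = mu h eS (tmap fA fB x)) ->
  (forall x, g (mu h eT x) = mu h eT (tmap gC gD x)) ->
  forall x, conv e f g (mu h e' x)
    = mu h e' (tmap (conv eS' fA gC) (conv eT' fB gD) x).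
Proof.
move=> cc e e' eS eT eS' eT' f g fA fB gC gD ef eg x.
rewrite {1}/conv /= [X in tmap f g X](bim_mul_comul e' e eS' eT' eS eT).
rewrite tmap_comp.
rewrite (eq_tmap (f' := mu h eS \o tmap fA fB)
  (g' := mu h eT \o tmap gC gD)) //.
by rewrite -tmap_comp -tmid_tmap (mul_shuffle cc e' e eS' eT' eS eT) !tmap_comp.
Qed.

(** * Higher operations as iterated convolutions *)

Lemma castS_id I (e : I = I) x : castS h e x = x.
Proof. by rewrite (eq_axiomK e). Qed.

Definition higher_op I F (e : is_decomp I F) : 'End I :=
  higher_mu h e \o higher_Delta h e.

Lemma eq_higher_op I F G (eF : is_decomp I F) (eG : is_decomp I G) :
  F = G -> higher_op eF =1 higher_op eG.
Proof. by move=> E; subst G; rewrite (bool_irrelevance eF eG). Qed.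

Lemma higher_op_nil (e : is_decomp set0 [::]) : higher_op e =1 unit_counit.
Proof. by move=> x; rewrite /higher_op /= !castS_id. Qed.

Lemma higher_op_one I (e : is_decomp I [:: I]) : higher_op e =1 id.
Proof. by move=> x; rewrite /higher_op /= !castS_id. Qed.

(** For a nonempty tail this is the recursion defining the higher operations. For a single block
    these are identities by definition, and the formula becomes the right unit law of
    convolution. *)
Lemma higher_op_cons I A T F (e : is_decomp I (A :: F)) (eA : splits I A T)
    (eF : is_decomp T F) :
  higher_op e =1 conv eA idfun (higher_op eF).
Proof.
case: F e eF => [|B F] e eF x.
  have /esym T0 := is_decomp_nil eF; have AI := is_decomp_one e; subst T A.
  rewrite higher_op_one -[LHS](convf0 eA idfun).
  by apply: eq_conv => // y; rewrite higher_op_nil.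
have ET : \bigcup_(S <- B :: F) S = T by case/andP: eF => _ /eqP.
subst T; rewrite /conv /= (bool_irrelevance eA (is_decomp_splits e)).
rewrite (bool_irrelevance eF (is_decomp_behead e)).
rewrite -[LHS]/(mu h _ (tmap idfun (higher_mu h (is_decomp_behead e))
  (tmap idfun (higher_Delta h (is_decomp_behead e)) (Delta h _ x)))).
by rewrite tmap_comp; congr (mu h _ _); apply: eq_tmap.
Qed.

(** By induction on F, from the left unit law and associativity of convolution. *)
Lemma higher_op_cat I S T F G (e : splits I S T) (eF : is_decomp S F)
    (eG : is_decomp T G) (eFG : is_decomp I (F ++ G)) :
  higher_op eFG =1 conv e (higher_op eF) (higher_op eG).
Proof.
elim: F I S e eF eFG => [|A F IH] I S e eF eFG x.
  have S0 := is_decomp_nil eF; subst S.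
  have IT : I = T by case/andP: e => /eqP <- _; rewrite set0U.
  subst I; rewrite (eq_conv e e (higher_op_nil eF) (g' := higher_op eG)) //.
  by rewrite conv0f; apply: eq_higher_op.
have /decomp_consP[B eS eB] := eF.
have [e1 e2] := splits_assoc (splitsC e) (splitsC eS).
move: (splitsC e1) (splitsC e2) => {}e1 {}e2.
have eBG := cat_decomp e2 eB eG.
rewrite (higher_op_cons _ e1 eBG).
rewrite (eq_conv e e (higher_op_cons eF eS eB) (g' := higher_op eG)) //.
rewrite (convA _ e2 _ e1); exact: eq_conv.
Qed.

(** * Higher operations against coproducts and products *)

(** By induction on F: op_F is the convolution of an identity, which is compatible with coproducts,
    and the operation of the tail, so [comul_conv] applies. *)
Lemma comul_higher_op I S T F (e : splits I S T) (eF : is_decomp I F)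
    (eS : is_decomp S (restrict S F)) (eT : is_decomp T (restrict T F)) :
  cocommutative_bimonoid h -> forall x,
  Delta h e (higher_op eF x) = tmap (higher_op eS) (higher_op eT) (Delta h e x).
Proof.
move=> cc; elim: F I S T e eF eS eT => [|A F IH] I S T e eF eS eT x.
  have I0 := is_decomp_nil eF; have S0 := is_decomp_nil eS.
  have T0 := is_decomp_nil eT; subst I S T.
  rewrite higher_op_nil comul_unit_counit.
  by apply: eq_tmap => y; rewrite higher_op_nil.
have /decomp_consP[B eAB eB] := eF.
have eA' := splits_setI e (splits_subl eAB).
have eB' := splits_setI e (splits_subr eAB).
have eS' : splits S (S :&: A) (S :&: B).
  by have := splits_setI eAB (splits_subl e); rewrite !(setIC S).
have eT' : splits T (T :&: A) (T :&: B).
  by have := splits_setI eAB (splits_subr e); rewrite !(setIC T).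
have eSB : is_decomp (S :&: B) (restrict S F).
  by rewrite (restrict_setI _ eB); apply: restrict_decomp eB; apply: subsetIr.
have eTB : is_decomp (T :&: B) (restrict T F).
  by rewrite (restrict_setI _ eB); apply: restrict_decomp eB; apply: subsetIr.
rewrite (higher_op_cons _ eAB eB).
rewrite (comul_conv cc eAB e (eS := eA') (eT := eB') eS' eT'
  (fA := idfun) (fB := idfun) (gC := higher_op eSB) (gD := higher_op eTB)).
- by apply: eq_tmap => y; apply/esym; apply: higher_op_cons.
- by move=> y; rewrite tmap_id.
- move=> y; move: (eSB) (eTB).
  (* The tail lives on B, so restricting it to S or T is restricting it to the traces of S and T on
     B; these split B as the induction hypothesis requires. *)
  rewrite (restrict_setI _ eB) (restrict_setI T eB).
  by move=> eSB' eTB'; rewrite (IH _ _ _ eB' eB eSB' eTB').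
Qed.

Lemma higher_op_mul I S T F (e : splits I S T) (eF : is_decomp I F)
    (eS : is_decomp S (restrict S F)) (eT : is_decomp T (restrict T F)) :
  commutative_bimonoid h -> forall x,
  higher_op eF (mu h e x) = mu h e (tmap (higher_op eS) (higher_op eT) x).
Proof.
move=> cc; elim: F I S T e eF eS eT => [|A F IH] I S T e eF eS eT x.
  have I0 := is_decomp_nil eF; have S0 := is_decomp_nil eS.
  have T0 := is_decomp_nil eT; subst I S T.
  rewrite higher_op_nil unit_counit_mul; congr (mu h e _).
  by apply: eq_tmap => y; rewrite higher_op_nil.
have /decomp_consP[B eAB eB] := eF.
have eA' := splits_setI e (splits_subl eAB).
have eB' := splits_setI e (splits_subr eAB).
have eS' : splits S (S :&: A) (S :&: B).
  by have := splits_setI eAB (splits_subl e); rewrite !(setIC S).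
have eT' : splits T (T :&: A) (T :&: B).
  by have := splits_setI eAB (splits_subr e); rewrite !(setIC T).
have eSB : is_decomp (S :&: B) (restrict S F).
  by rewrite (restrict_setI _ eB); apply: restrict_decomp eB; apply: subsetIr.
have eTB : is_decomp (T :&: B) (restrict T F).
  by rewrite (restrict_setI _ eB); apply: restrict_decomp eB; apply: subsetIr.
rewrite (higher_op_cons _ eAB eB).
rewrite (conv_mul cc eAB e (eS := eA') (eT := eB') eS' eT'
  (fA := idfun) (fB := idfun) (gC := higher_op eSB) (gD := higher_op eTB)).
- by congr (mu h e _); apply: eq_tmap => y; apply/esym; apply: higher_op_cons.
- by move=> y; rewrite tmap_id.
- move=> y; move: (eSB) (eTB).
  rewrite (restrict_setI _ eB) (restrict_setI T eB).
  by move=> eSB' eTB'; rewrite (IH _ _ _ eB' eB eSB' eTB').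
Qed.

(** * Higher operations of a Tits product *)

Lemma tits_blocks_restrict T F G :
  is_decomp T F -> tits_blocks F G = tits_blocks F (restrict T G).
Proof.
move=> eF; congr flatten; apply/eq_in_map => A /(decomp_sub eF)/setIidPl AT.
by rewrite -map_comp; apply: eq_map => B /=; rewrite setIA AT.
Qed.

Lemma tits_blocks_decomp I F G :
  is_decomp I F -> is_decomp I G -> is_decomp I (tits_blocks F G).
Proof. by move=> eF eG; apply: (tits_blocksP (Decomp eF) (Decomp eG)). Qed.

(** Lexicographic order lists the intersections with A first, so the Tits product is a concatenation
    and [higher_op_cat] applies. *)
Lemma higher_op_tits_cons I A T F G (eG : is_decomp I G) (e : splits I A T)
    (eA : is_decomp A (restrict A G)) (eT : is_decomp T (restrict T G))
    (eF : is_decomp T F)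
    (eFG : is_decomp I (tits_blocks (A :: F) G)) :
  higher_op eFG =1 conv e (higher_op eA) (higher_op (tits_blocks_decomp eF eT)).
Proof.
(* The proof term is generalised so that G|T can be replaced by G in its type. *)
move: (tits_blocks_decomp eF eT).
rewrite -(tits_blocks_restrict G eF) => eFG' x.
by move: eFG; rewrite /tits_blocks allpairs_cons => eFG; apply: higher_op_cat.
Qed.

(** All blocks are empty here, and the counit is compatible with the product. This settles the empty
    F in the cocommutative case, where op_F begins with the counit. *)
Lemma counit_higher_op F (eF : is_decomp set0 F) x :
  epsilon0 h K (higher_op eF x) = epsilon0 h K x.
Proof.
elim: F eF x => [|A F IH] eF x.
  by rewrite higher_op_nil; apply: (bim_unit_counit h).
have /decomp_consP[T e eT] := eF.
have [/eqP A0 /eqP T0] : A == set0 /\ T == set0.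
  by rewrite -!subset0 (splits_subl e) (splits_subr e).
subst A T; rewrite (higher_op_cons _ e eT) [LHS](bim_mul_counit e) tmap_comp.
rewrite -[RHS]mulr1 -[RHS](tlunitE (U := k^o)) -(counit_counit_comul e).
by congr (tlunit _ _); apply: eq_tmap => // y; apply: IH.
Qed.

(** Dual to [counit_higher_op]: it settles the empty F in the commutative case, where op_F ends with
    the unit map. *)
Lemma higher_op_unit F (eF : is_decomp set0 F) a :
  higher_op eF (iota0 h K a) = iota0 h K a.
Proof.
elim: F eF a => [|A F IH] eF a.
  by rewrite higher_op_nil /=; congr (iota0 h K _); apply: (bim_unit_counit h).
have /decomp_consP[T e eT] := eF.
have [/eqP A0 /eqP T0] : A == set0 /\ T == set0.
  by rewrite -!subset0 (splits_subl e) (splits_subr e).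
subst A T; rewrite (higher_op_cons _ e eT) iota0E !linearZ; congr (_ *: _).
rewrite /conv /= [X in tmap _ _ X](bim_unit_comul h e) tmapE IH.
have := mon_unitl (bim_monoid h) e (tensor (1 : k^o) (iota0 h K 1)).
by rewrite tmapE tlunitE scale1r.
Qed.

Lemma higher_op_tits_cocommutative I F G (eF : is_decomp I F)
    (eG : is_decomp I G) (eFG : is_decomp I (tits_blocks F G)) :
  cocommutative_bimonoid h -> forall x,
  higher_op eFG x = higher_op eF (higher_op eG x).
Proof.
move=> cc; elim: F I G eF eG eFG => [|A F IH] I G eF eG eFG x.
  have I0 := is_decomp_nil eF; subst I.
  by rewrite !higher_op_nil /= counit_higher_op.
have /decomp_consP[T e eT] := eF.
have eGA := restrict_decomp (splits_subl e) eG.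
have eGT := restrict_decomp (splits_subr e) eG.
rewrite (higher_op_tits_cons eG e eGA eGT eT) (higher_op_cons _ e eT) /conv /=.
(* The coproduct that opens op_F passes through op_G; on the second factor the claim for the tail
   and G|T remains. *)
rewrite (comul_higher_op e eG eGA eGT cc) tmap_comp; congr (mu h e _).
by apply: eq_tmap => // y; apply: IH.
Qed.

Lemma higher_op_tits_commutative I F G (eF : is_decomp I F)
    (eG : is_decomp I G) (eFG : is_decomp I (tits_blocks F G)) :
  commutative_bimonoid h -> forall x,
  higher_op eFG x = higher_op eG (higher_op eF x).
Proof.
move=> cc; elim: F I G eF eG eFG => [|A F IH] I G eF eG eFG x.
  have I0 := is_decomp_nil eF; subst I.
  by rewrite !higher_op_nil [RHS]higher_op_unit.
have /decomp_consP[T e eT] := eF.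
have eGA := restrict_decomp (splits_subl e) eG.
have eGT := restrict_decomp (splits_subr e) eG.
rewrite (higher_op_tits_cons eG e eGA eGT eT) (higher_op_cons _ e eT).
(* Here op_G is applied after the product that closes op_F and is pulled inside it, acting as G|A
   and G|T on the two factors. *)
rewrite [RHS](higher_op_mul e eG eGA eGT cc) /= tmap_comp; congr (mu h e _).
by apply: eq_tmap => // y; apply: IH.
Qed.

End Convolution.

(** * Linear extension to the characteristic operation *)

Lemma fglift_sum (R : nzRingType) (D : choiceType) (V : lmodType R) (f : D -> V)
    (J : Type) (r : seq J) (z : J -> {freeg D / R}) :
  fglift f (\sum_(j <- r) z j) = \sum_(j <- r) fglift f (z j).
Proof.
pose L : {additive {freeg D / R} -> V} :=
  HB.pack (fglift f) (GRing.isZmodMorphism.Build _ _ _ (lift_is_additive f)).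
exact: (raddf_sum L).
Qed.

Section CharacteristicOperation.
Context (k : fieldType) (h : bimonoid k) (K : finType) (I : {set K}).
Implicit Types (F G : decomp I) (z w : hSigma k I) (x : h (elts I)).

(** As a linear extension the operation is additive in z, with no reference to the support of z. *)
Lemma char_opE z x :
  char_op z x = fglift (fun F => higher_op h (blocksP F) x) z.
Proof.
rewrite -[z in RHS]freeg_sumE.
rewrite fglift_sum; apply: eq_bigr => F _.
by rewrite liftU.
Qed.

Lemma char_op_basis F x : char_op (basisH k F) x = higher_op h (blocksP F) x.
Proof. by rewrite char_opE liftU scale1r. Qed.

(** Different pairs F, G may have the same product FG, so the support of [tits z w] is not indexed
    by pairs; additivity allows summing over pairs all the same. *)
Lemma char_op_tits z w x :
  char_op (tits z w) x = \sum_(F <- dom z) \sum_(G <- dom w)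
    (coeff F z * coeff G w) *: higher_op h (blocksP (tits_decomp F G)) x.
Proof.
rewrite char_opE fglift_sum; apply: eq_bigr => F _.
rewrite fglift_sum; apply: eq_bigr => G _.
have -> : (coeff F z * coeff G w) *: basisH k (tits_decomp F G)
    = << coeff F z * coeff G w *g tits_decomp F G >>.
  by apply/eqP/freeg_eqP => H; rewrite coeffZ !coeffU mul1r.
exact: liftU.
Qed.

Lemma char_op_comp z w x :
  char_op z (char_op w x) = \sum_(F <- dom z) \sum_(G <- dom w)
    (coeff F z * coeff G w)
      *: higher_op h (blocksP F) (higher_op h (blocksP G) x).
Proof.
apply: eq_bigr => F _; rewrite -[LHS]/(_ *: higher_op h (blocksP F) _).
rewrite linear_sum scaler_sumr; apply: eq_bigr => G _.
by rewrite linearZ scalerA.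
Qed.

End CharacteristicOperation.

Theorem theorem82 (k : fieldType) (h : bimonoid k) (K : finType) (I : {set K}) :
  (forall x : h (elts I), char_op (basisH k (one_block I)) x = x)
  /\ (cocommutative_bimonoid h ->
      forall (z w : hSigma k I) (x : h (elts I)),
        char_op (tits z w) x = char_op z (char_op w x))
  /\ (commutative_bimonoid h ->
      forall (z w : hSigma k I) (x : h (elts I)),
        char_op (tits z w) x = char_op w (char_op z x)).
Proof.
split=> [x|]; first by rewrite char_op_basis higher_op_one.
(* Everything reduces to pairs of basis elements. In the commutative case w acts last, so the sum
   over G is moved outside to match. *)
split=> hC z w x; rewrite char_op_tits char_op_comp;
  last rewrite exchange_big /=.
- apply: eq_bigr => F _; apply: eq_bigr => G _; congr (_ *: _).
  exact: higher_op_tits_cocommutative.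
- apply: eq_bigr => G _; apply: eq_bigr => F _; rewrite mulrC; congr (_ *: _).
  exact: higher_op_tits_commutative.
Qed.
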